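(* Let $H$ be a complex Hilbert space and $M_0,M_1\in L(H)$. Assume that $R(M_0)$ is closed and let $\mathcal{M}$ be the linear operator pencil associated with $(M_0,M_1)$, i.e. $\mathcal{M}(z)=zM_0+M_1$ for $z\in\mathbb{C}$. Then the following statements are equivalent: (i) $\mathcal{M}$ is regular; (ii) $\iota_{R(M_0)^\perp}^{*}M_1\iota_{N(M_0)}:N(M_0)\to R(M_0)^\perp$ is continuously invertible. In the latter case, $\sigma(\mathcal{M})=\sigma(-\tilde M_0^{-1}\tilde M_1)$ is compact and for each $z\in\mathbb{C}$ $$\mathcal{M}(z)=U_1^{*}V_1\begin{pmatrix} z\tilde M_0+\tilde M_1 & 0\\ 0& \iota_{R(M_0)^\perp}^{*}M_1\iota_{N(M_0)}\end{pmatrix}V_0U_0,$$ where $$U_0:=\begin{pmatrix}\iota_{N(M_0)^\perp}^{*}\\ \iota_{N(M_0)}^{*}\end{pmatrix}:H\to N(M_0)^\perp\oplus N(M_0),\qquad U_1:=\begin{pmatrix}\iota_{R(M_0)}^{*}\\ \iota_{R(M_0)^\perp}^{*}\end{pmatrix}:H\to R(M_0)\oplus R(M_0)^\perp,$$ $$V_0:=\begin{pmatrix}1&0\\ \left(\iota_{R(M_0)^\perp}^{*}M_1\iota_{N(M_0)}\right)^{-1}\left(\iota_{R(M_0)^\perp}^{*}M_1\iota_{N(M_0)^\perp}\right)&1\end{pmatrix}\in L(N(M_0)^\perp\oplus N(M_0)),$$ $$V_1:=\begin{pmatrix}1&\left(\iota_{R(M_0)}^{*}M_1\iota_{N(M_0)}\right)\left(\iota_{R(M_0)^\perp}^{*}M_1\iota_{N(M_0)}\right)^{-1}\\0&1\end{pmatrix}\in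 L(R(M_0)\oplus R(M_0)^\perp),$$ and $$\tilde M_0=\iota_{R(M_0)}^{*}M_0\iota_{N(M_0)^\perp},$$ $$\tilde M_1=\iota_{R(M_0)}^{*}M_1\iota_{N(M_0)^\perp}-\left(\iota_{R(M_0)}^{*}M_1\iota_{N(M_0)}\right)\left(\iota_{R(M_0)^\perp}^{*}M_1\iota_{N(M_0)}\right)^{-1}\left(\iota_{R(M_0)^\perp}^{*}M_1\iota_{N(M_0)^\perp}\right).$$
   Context: $L(H)$ is the space of bounded linear operators on $H$; $R(M)$ and $N(M)$ denote range and kernel of an operator $M$. For a closed subspace $S\subseteq H$, $\iota_S:S\hookrightarrow H$, $s\mapsto s$, is the canonical embedding; its adjoint $\iota_S^{*}:H\to S$ is the orthogonal projection onto $S$ (with codomain $S$). ''Continuously invertible'' means bijective with bounded inverse. The spectrum of the pencil $\mathcal{M}$ is $\sigma(\mathcal{M}):=\{z\in\mathbb{C}: 0\in\sigma(zM_0+M_1)\}$ and its resolvent set is $\varrho(\mathcal{M}):=\mathbb{C}\setminus\sigma(\mathcal{M})$. Write $\mathbb{C}_{\operatorname{Re}>\nu}:=\{z\in\mathbb{C}:\operatorname{Re}z>\nu\}$. The pencil $\mathcal{M}$ is called regular (of index $0$) if there is $\nu\in\mathbb{R}$ such that $\mathbb{C}_{\operatorname{Re}>\nu}\subseteq\varrho(\mathcal{M})$ and $\mathbb{C}_{\operatorname{Re}>\nu}\ni z\mapsto(zM_0+M_1)^{-1}\in L(H)$ is bounded. *)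

(* Defs.v *)
From HB Require Import structures.
From mathcomp Require Import all_boot all_order all_algebra complex.
From mathcomp Require Import all_classical all_reals all_analysis.
From mathcomp Require Import ring.

Set Implicit Arguments.
Unset Strict Implicit.
Unset Printing Implicit Defensive.

Import Order.TTheory GRing.Theory Num.Theory.
Import numFieldNormedType.Exports.

Local Open Scope classical_set_scope.
Local Open Scope ring_scope.

(* [complex.v] gives [R[i]] a modulus but no topology: take that of [R[i]^o]. *)
HB.instance Definition _ (R : realType) := NormedModule.copy R[i] R[i]^o.

Section DotOf.
Variables (C : numClosedFieldType) (V : lmodType C) (op : V -> V -> C).
Hypothesis opP : forall a x y z, op (a *: x + y) z = a * op x z + op y z.
Hypothesis opC : forall x y, op x y = (op y x)^*.
Hypothesis op_gt0 : forall x, x != 0 -> 0 < op x x.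

Let opPr a x y z : op z (a *: x + y) = a^* * op z x + op z y.
Proof. by rewrite opC opP rmorphD rmorphM /= -!opC. Qed.

Let opBl y : zmod_morphism (op^~ y).
Proof. exact: zmod_morphism_linear (fun a x z => opP a x z y). Qed.

Let opBr y : zmod_morphism (op y).
Proof.
by move=> x z; rewrite -[x - z]addrC -scaleN1r opPr rmorphN1 mulN1r addrC.
Qed.

Let opZl y : scalable_for *%R (op^~ y).
Proof. exact: scalable_linear (fun a x z => opP a x z y). Qed.

Let opZr y : scalable_for (Num.Def.conjC \; *%R) (op y).
Proof.
by move=> a x; rewrite -[a *: x]addr0 opPr -(subrr 0) opBr subrr addr0.
Qed.

Let opH x y : op x y = (-1) ^+ false * Num.Def.conjC (op y x).
Proof. by rewrite expr0 mul1r -opC. Qed.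

Definition dot_of : {dot V for @Num.Def.conjC C} := HB.pack op
  (isBilinear.Build _ _ _ _ _ _ op opBl opBr opZl opZr)
  (isHermitianSesquilinear.Build C V false _ op opH)
  (isDotProduct.Build C V op op_gt0).

End DotOf.

(* [dotp] is linear in its first argument, conjugate-linear in the second. *)
HB.mixin Record isHilbert (R : realType) H & CompleteNormedModule R[i] H := {
  dotp : {dot H for (@Num.Def.conjC R[i])} ;
  sqr_normE : forall x : H, `|x| ^+ 2 = dotp x x
}.

#[short(type="hilbertType")]
HB.structure Definition Hilbert (R : realType) :=
  {H of CompleteNormedModule R[i] H & isHilbert R H}.

Section ClosedSubspaces.
Context {R : realType}.

Record closed_subspace (H : hilbertType R) := ClosedSubspace {
  cs_set :> set H;
  cs_submod : submod_closed (mem cs_set);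
  cs_closed : closed cs_set }.

Variables (H : hilbertType R) (S : closed_subspace H).

Definition cs_pred : {pred H} := mem (cs_set S).

HB.instance Definition _ := GRing.isSubmodClosed.Build _ _ cs_pred (cs_submod S).

Record subsp := Subsp { subsp_val : H; _ : subsp_val \in cs_pred }.

HB.instance Definition _ := [isSub for subsp_val].
HB.instance Definition _ := [Choice of subsp by <:].
HB.instance Definition _ := [SubChoice_isSubLmodule of subsp by <:].

Let norm (x : subsp) : R[i] := `|subsp_val x|.
Let normD x y : norm (x + y) <= norm x + norm y.
Proof. exact: ler_normD. Qed.
Let normZ l x : norm (l *: x) = `|l| * norm x.
Proof. exact: normrZ. Qed.
Let norm0 x : norm x = 0 -> x = 0.
Proof. by move/normr0_eq0 => x0; apply: val_inj. Qed.
HB.instance Definition _ :=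
  Lmodule_isNormed.Build R[i] subsp normD normZ norm0.



Let dot (x y : subsp) : R[i] := dotp (subsp_val x) (subsp_val y).

Let dotP a x y z : dot (a *: x + y) z = a * dot x z + dot y z.
Proof. by rewrite /dot linearDl linearZl_LR. Qed.

Let dotC x y : dot x y = (dot y x)^*.
Proof. by rewrite /dot hermC/= expr0 mul1r. Qed.

Let dot_gt0 x : x != 0 -> 0 < dot x x.
Proof. by move=> x0; apply: neq0_dnorm_gt0; apply: contra_neq x0 => x0; apply: val_inj. Qed.

Let sqr_normE (x : subsp) : `|x| ^+ 2 = dot_of dotP dotC dot_gt0 x x.
Proof. exact: sqr_normE. Qed.

Let complete (F : set_system subsp) : ProperFilter F -> cauchy F -> cvg F.
Proof.
move=> FF /cauchy_ballP Fc.
have Gc : cauchy (subsp_val @ F).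
  apply/cauchy_ballP => e e0; rewrite near_map2.
  apply: filterS (Fc e e0) => -[x y] /=.
  by rewrite -!ball_normE.
have [l Gl] := (iffLR (cvg_ex _)) (@cauchy_cvg H _ _ Gc).
have Sl : cs_set S l.
  apply: (closed_cvg _ (@cs_closed _ S) _ l Gl).
  by apply: nearW => -[x /= /set_mem].
apply/cvg_ex; exists (Subsp (mem_set Sl)).
apply/fcvg_ballP => e e0; apply: filterS (cvg_ball Gl e0) => x.
by rewrite -!ball_normE.
Qed.

HB.instance Definition _ := Uniform_isComplete.Build subsp complete.
HB.instance Definition _ := isHilbert.Build R subsp sqr_normE.

End ClosedSubspaces.

Lemma minkowski2 (C : numClosedFieldType) (a b c d : C) :
    0 <= a -> 0 <= b -> 0 <= c -> 0 <= d ->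
  sqrtC ((a + c) ^+ 2 + (b + d) ^+ 2) <=
  sqrtC (a ^+ 2 + b ^+ 2) + sqrtC (c ^+ 2 + d ^+ 2).
Proof.
move=> a0 b0 c0 d0.
have sq0 (x y : C) : 0 <= x -> 0 <= y -> 0 <= x ^+ 2 + y ^+ 2.
  by move=> x0 y0; rewrite addr_ge0// exprn_ge0.
have [ab cd] := (sq0 _ _ a0 b0, sq0 _ _ c0 d0).
have abcd := sq0 _ _ (addr_ge0 a0 c0) (addr_ge0 b0 d0).
rewrite -ler_sqr ?nnegrE ?addr_ge0 ?sqrtC_ge0//.
rewrite [leRHS]sqrrD !sqrtCK -sqrtCM ?nnegrE//.
rewrite [leLHS](_ : _ = a ^+ 2 + b ^+ 2 + (a * c + b * d) *+ 2 +
  (c ^+ 2 + d ^+ 2)); last by ring.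
rewrite lerD2r lerD2l lerMn2r/=.
have p0 : 0 <= a * c + b * d by rewrite addr_ge0 ?mulr_ge0.
rewrite -ler_sqr ?nnegrE ?sqrtC_ge0 ?mulr_ge0//.
rewrite sqrtCK -subr_ge0 [leRHS](_ : _ = (a * d - b * c) ^+ 2); last by ring.
by rewrite real_exprn_even_ge0// realB// ger0_real// mulr_ge0.
Qed.

Section DirectSum.
Context {R : realType}.
Variables H K : hilbertType R.

(* An alias of the product, which the library equips with the max norm: the
   orthogonal direct sum carries the norm of the inner product below. *)
Definition dsum : Type := (H * K)%type.

HB.instance Definition _ := GRing.Lmodule.copy dsum (H * K)%type.

Let norm (x : dsum) : R[i] := sqrtC (`|x.1| ^+ 2 + `|x.2| ^+ 2).

Let norm_sqr_ge0 (x : dsum) : 0 <= `|x.1| ^+ 2 + `|x.2| ^+ 2.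
Proof. by rewrite addr_ge0// exprn_ge0. Qed.

Let normD x y : norm (x + y) <= norm x + norm y.
Proof.
apply: (le_trans _ (minkowski2 _ _ _ _)) => //.
rewrite ler_sqrtC ?nnegrE ?norm_sqr_ge0 ?addr_ge0 ?exprn_ge0 ?addr_ge0//.
by rewrite lerD// lerXn2r ?nnegrE ?addr_ge0 ?ler_normD.
Qed.

Let normZ l x : norm (l *: x) = `|l| * norm x.
Proof.
rewrite /norm /= !normrZ !exprMn -mulrDr sqrtCM ?nnegrE ?exprn_ge0 ?norm_sqr_ge0//.
by rewrite sqrCK.
Qed.

Let norm0 x : norm x = 0 -> x = 0.
Proof.
move/eqP; rewrite sqrtC_eq0 paddr_eq0 ?exprn_ge0// !sqrf_eq0 !normr_eq0.
by case: x => x y /= /andP[/eqP-> /eqP->].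
Qed.

HB.instance Definition _ := Lmodule_isNormed.Build R[i] dsum normD normZ norm0.

Let dot (x y : dsum) : R[i] := dotp x.1 y.1 + dotp x.2 y.2.

Let dotP a x y z : dot (a *: x + y) z = a * dot x z + dot y z.
Proof.
by rewrite /dot/= !linearDl/= !linearZl_LR mulrDr addrACA.
Qed.

Let dotC x y : dot x y = (dot y x)^*.
Proof.
rewrite /dot rmorphD.
by congr (_ + _); rewrite hermC/= expr0 mul1r.
Qed.

Let sqr_norm_dot x : `|x| ^+ 2 = dot x x.
Proof. by rewrite {1}/Num.norm/= sqrtCK !sqr_normE. Qed.

Let dot_gt0 x : x != 0 -> 0 < dot x x.
Proof. by move=> x0; rewrite -sqr_norm_dot exprn_gt0// normr_gt0. Qed.

Let sqr_normE (x : dsum) : `|x| ^+ 2 = dot_of dotP dotC dot_gt0 x x.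
Proof. exact: sqr_norm_dot. Qed.

Lemma dsum_norm1_le (x : dsum) : `|x.1| <= `|x|.
Proof.
rewrite -ler_sqr ?nnegrE// [`|x|]/Num.norm/= sqrtCK.
by rewrite lerDl exprn_ge0.
Qed.

Lemma dsum_norm2_le (x : dsum) : `|x.2| <= `|x|.
Proof.
rewrite -ler_sqr ?nnegrE// [`|x|]/Num.norm/= sqrtCK.
by rewrite lerDr exprn_ge0.
Qed.

Lemma dsum_norm_le (x : dsum) : `|x| <= `|x.1| + `|x.2|.
Proof.
rewrite -ler_sqr ?nnegrE ?addr_ge0// [`|x|]/Num.norm/= sqrtCK sqrrD.
by rewrite addrAC lerDl mulrn_wge0// mulr_ge0.
Qed.

Let complete (F : set_system dsum) : ProperFilter F -> cauchy F -> cvg F.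
Proof.
move=> FF /cauchy_ballP Fc.
have c1 : cauchy ((fst : dsum -> H) @ F).
  apply/cauchy_ballP => e e0; rewrite near_map2.
  apply: filterS (Fc e e0) => -[x y] /=; rewrite -!ball_normE.
  exact: le_lt_trans (dsum_norm1_le (x - y)).
have c2 : cauchy ((snd : dsum -> K) @ F).
  apply/cauchy_ballP => e e0; rewrite near_map2.
  apply: filterS (Fc e e0) => -[x y] /=; rewrite -!ball_normE.
  exact: le_lt_trans (dsum_norm2_le (x - y)).
have [l1 Fl1] := (iffLR (cvg_ex _)) (@cauchy_cvg H _ _ c1).
have [l2 Fl2] := (iffLR (cvg_ex _)) (@cauchy_cvg K _ _ c2).
apply/cvg_ex; exists ((l1, l2) : dsum); apply/fcvg_ballP => e e0.
have e2 : 0 < e / 2 by rewrite divr_gt0.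
apply: filterS2 (cvg_ball Fl1 e2) (cvg_ball Fl2 e2) => x.
rewrite -!ball_normE/= => x1 x2.
apply: le_lt_trans (dsum_norm_le _) _.
by rewrite (splitr e) ltrD.
Qed.

HB.instance Definition _ := Uniform_isComplete.Build dsum complete.
HB.instance Definition _ := isHilbert.Build R dsum sqr_normE.

End DirectSum.

Section BoundedOperators.
Context {R : realType}.
Variables H K : hilbertType R.

Definition bop_pred : {pred H -> K} := fun f =>
  `[< linear f /\ exists c : R[i], forall x, `|f x| <= c * `|x| >].

Lemma bop_predP (f : H -> K) :
  reflect (linear f /\ exists c : R[i], forall x, `|f x| <= c * `|x|)
          (f \in bop_pred).
Proof. exact: asboolP. Qed.

Lemma bop_pred_ge0 (f : H -> K) : f \in bop_pred ->
  linear f /\ exists2 c : R[i], 0 <= c & forall x, `|f x| <= c * `|x|.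
Proof.
move=> /bop_predP[lf [c fc]]; split=> //; exists `|c|; first exact: normr_ge0.
move=> x; apply: le_trans (fc x) _.
have : 0 <= c * `|x| by apply: le_trans (fc x).
by move/ger0_norm <-; rewrite normrM normr_id.
Qed.

Let bop_submod : submod_closed bop_pred.
Proof.
split=> [|a f g fP gP].
  apply/bop_predP; split=> [a x y|]; first by rewrite scaler0 addr0.
  by exists 0 => x; rewrite normr0 mul0r.
have [lf [c c0 fc]] := bop_pred_ge0 fP.
have [lg [d d0 gd]] := bop_pred_ge0 gP.
apply/bop_predP; split=> [b x y|].
  rewrite !fctE lf lg !scalerDr !scalerA addrACA [a * b]mulrC.
  by [].
exists (`|a| * c + d) => x; rewrite !fctE.
apply: le_trans (ler_normD _ _) _; rewrite normrZ mulrDl lerD//.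
by rewrite -mulrA ler_wpM2l.
Qed.

HB.instance Definition _ := GRing.isSubmodClosed.Build _ _ bop_pred bop_submod.

Record bop := Bop { bop_fun :> H -> K; _ : bop_fun \in bop_pred }.

HB.instance Definition _ := [isSub for bop_fun].
HB.instance Definition _ := [Choice of bop by <:].
HB.instance Definition _ := [SubChoice_isSubLmodule of bop by <:].

Lemma bop_linear (A : bop) : linear A.
Proof. by case: A => f fP; have [] := bop_pred_ge0 fP. Qed.

HB.instance Definition _ (A : bop) := GRing.isLinear.Build _ _ _ _ A (bop_linear A).

Lemma bop_bounded (A : bop) :
  exists2 c : R[i], 0 <= c & forall x, `|A x| <= c * `|x|.
Proof. by case: A => f fP; have [] := bop_pred_ge0 fP. Qed.

Definition mkbop (f : H -> K) (lf : linear f)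
    (bf : exists c : R[i], forall x, `|f x| <= c * `|x|) : bop :=
  Bop (introT (bop_predP _) (conj lf bf)).

Lemma bop_continuous (A : bop) : continuous A.
Proof.
have [c c0 Ac] := bop_bounded A.
apply: bounded_linear_continuous; apply/linear_boundedP.
exists c; split; first exact: ger0_real.
by move=> r /ltW cr x; apply: le_trans (Ac x) _; rewrite ler_wpM2r.
Qed.

End BoundedOperators.

Section Operators.
Context {R : realType}.
Implicit Types H K L : hilbertType R.

Let bid_bounded H : exists c : R[i], forall x : H, `|x| <= c * `|x|.
Proof. by exists 1 => x; rewrite mul1r. Qed.

Definition bid H : bop H H :=
  @mkbop R H H id (fun _ _ _ => erefl) (bid_bounded H).

Section Comp.
Variables (H K L : hilbertType R) (B : bop K L) (A : bop H K).

Let comp_linear : linear (B \o A).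
Proof. by move=> a x y; rewrite /= !linearP. Qed.

Let comp_bounded : exists c : R[i], forall x, `|(B \o A) x| <= c * `|x|.
Proof.
have [[b b0 Bb] [a a0 Aa]] := (bop_bounded B, bop_bounded A).
exists (b * a) => x; apply: le_trans (Bb (A x)) _.
by rewrite -mulrA; apply: ler_wpM2l.
Qed.

Definition bcomp : bop H L := mkbop comp_linear comp_bounded.

End Comp.

Section Embedding.
Variables (H : hilbertType R) (S : closed_subspace H).

Let emb_linear : linear (@subsp_val R H S).
Proof. by []. Qed.

Let emb_bounded :
  exists c : R[i], forall x : subsp S, `|subsp_val x| <= c * `|x|.
Proof. by exists 1 => x; rewrite mul1r. Qed.

Definition emb : bop (subsp S) H := mkbop emb_linear emb_bounded.

End Embedding.

Section Blocks.
Variables H1 H2 K1 K2 : hilbertType R.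

Section Col.
Variables (A : bop H1 K1) (B : bop H1 K2).

Let col (x : H1) : dsum K1 K2 := (A x, B x).

Let col_linear : linear col.
Proof. by move=> a x y; rewrite /col !linearP. Qed.

Let col_bounded : exists c : R[i], forall x, `|col x| <= c * `|x|.
Proof.
have [[a a0 Aa] [b b0 Bb]] := (bop_bounded A, bop_bounded B).
exists (a + b) => x; apply: le_trans (dsum_norm_le _) _.
by rewrite mulrDl; apply: lerD; [exact: Aa|exact: Bb].
Qed.

(* The operator with block matrix (A; B), one column. *)
Definition bcol : bop H1 (dsum K1 K2) := mkbop col_linear col_bounded.

End Col.

Section Block.
Variables (A : bop H1 K1) (B : bop H2 K1) (C : bop H1 K2) (D : bop H2 K2).

Let block (x : dsum H1 H2) : dsum K1 K2 := (A x.1 + B x.2, C x.1 + D x.2).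

Let block_linear : linear block.
Proof.
move=> a x y; rewrite /block /= !linearP /=.
rewrite (addrACA _ (A y.1)) (addrACA _ (C y.1)) -!scalerDr.
by [].
Qed.

Let block_bounded : exists c : R[i], forall x, `|block x| <= c * `|x|.
Proof.
have [[a a0 Aa] [b b0 Bb]] := (bop_bounded A, bop_bounded B).
have [[c c0 Cc] [d d0 Dd]] := (bop_bounded C, bop_bounded D).
exists (a + b + (c + d)) => x; apply: le_trans (dsum_norm_le _) _.
rewrite !mulrDl; apply: lerD; apply: le_trans (ler_normD _ _) _; apply: lerD.
- by apply: le_trans (Aa _) _; apply: ler_wpM2l => //; exact: dsum_norm1_le.
- by apply: le_trans (Bb _) _; apply: ler_wpM2l => //; exact: dsum_norm2_le.
- by apply: le_trans (Cc _) _; apply: ler_wpM2l => //; exact: dsum_norm1_le.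
- by apply: le_trans (Dd _) _; apply: ler_wpM2l => //; exact: dsum_norm2_le.
Qed.

(* The operator with block matrix (A B; C D). *)
Definition bblock : bop (dsum H1 H2) (dsum K1 K2) :=
  mkbop block_linear block_bounded.

End Block.
End Blocks.

Section Inner.
Variable H : hilbertType R.

Lemma dotp_CauchySchwarz (x y : H) : `|dotp x y| <= `|x| * `|y|.
Proof.
have [->|y0] := eqVneq y 0; first by rewrite linear0r !normr0 mulr0.
have yy0 : 0 < dotp y y by exact: neq0_dnorm_gt0.
rewrite -ler_sqr ?nnegrE ?mulr_ge0// exprMn !sqr_normE.
set a := dotp x y / dotp y y.
have [u xE uy] : exists2 u, x = u + a *: y & dotp u y = 0.
  exists (x - a *: y); first by rewrite subrK.
  by rewrite linearBl/= linearZl_LR divfK ?subrr// gt_eqF.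
have -> : dotp x x = dotp u u + `|a| ^+ 2 * dotp y y.
  have uay : dotp u (a *: y) = 0 by rewrite linearZr_LR/= uy mulr0.
  by rewrite xE hnormDd// linearZl_LR linearZr_LR/= mulrA normCK.
have -> : `|dotp x y| = `|a| * dotp y y.
  by rewrite normrM normfV (gtr0_norm yy0) divfK// gt_eqF.
have -> : (`|a| * dotp y y) ^+ 2 = `|a| ^+ 2 * dotp y y * dotp y y by ring.
rewrite mulrDl lerDr; apply: mulr_ge0; last exact: ltW.
by rewrite -sqr_normE exprn_ge0.
Qed.

End Inner.

Section Subspaces.
Variables H K : hilbertType R.

Section Ker.
Variable A : bop H K.
Let ker_set : set H := [set x | A x = 0].
Let ker_submod : submod_closed (mem ker_set).
Proof.
split=> [|a x y]; rewrite !inE /ker_set/= ?linear0// => Ax Ay.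
by rewrite linearP/= Ax Ay scaler0 addr0.
Qed.
Let ker_closed : closed ker_set.
Proof.
have -> : ker_set = A @^-1` [set 0] by [].
apply: preimage_closed; first by move=> x _; exact: bop_continuous.
exact: accessible_closed_set1 (hausdorff_accessible (@norm_hausdorff _ K)) _.
Qed.
Definition ker : closed_subspace H := ClosedSubspace ker_submod ker_closed.
End Ker.

Section Ran.
Variable A : bop H K.
Let ran_submod : submod_closed (mem (range A)).
Proof.
split=> [|a x y]; rewrite !inE.
  by exists 0 => //; rewrite linear0.
by move=> [u _ <-] [v _ <-]; exists (a *: u + v) => //; rewrite linearP.
Qed.
Definition ran (clA : closed (range A)) : closed_subspace K :=
  ClosedSubspace ran_submod clA.
End Ran.

Section Orth.
Variable S : set H.
Let orth_set : set H := [set x | forall y, S y -> dotp x y = 0].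
Let orth_submod : submod_closed (mem orth_set).
Proof.
split=> [|a x y]; rewrite !inE /orth_set/=.
  by move=> y Sy; rewrite linear0l.
move=> xS yS z Sz; rewrite linearDl/= linearZl_LR/= xS// yS// mulr0 addr0.
by [].
Qed.
Let orth_closed : closed orth_set.
Proof.
have -> : orth_set = \bigcap_(y in S) (fun x => dotp x y : R[i]^o) @^-1` [set 0].
  by [].
apply: closed_bigI => y Sy; apply: preimage_closed.
  move=> x _; have lf : linear (fun x => dotp x y : R[i]^o).
    by move=> a u v; rewrite linearDl/= linearZl_LR.
  pose f : {linear H -> R[i]^o} := HB.pack (fun x => dotp x y : R[i]^o)
    (GRing.isLinear.Build _ _ _ _ _ lf).
  apply: (@bounded_linear_continuous _ _ _ f); apply/linear_boundedP.
  exists `|y|; split; first exact: normr_real.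
  move=> r /ltW yr u; apply: le_trans (dotp_CauchySchwarz _ _) _.
  by rewrite mulrC ler_wpM2r.
exact: accessible_closed_set1 (hausdorff_accessible (@norm_hausdorff _ _)) _.
Qed.
Definition orth : closed_subspace H := ClosedSubspace orth_submod orth_closed.
End Orth.

End Subspaces.
End Operators.

Notation "B \ob A" := (bcomp B A) (at level 40, left associativity).

Section Adjoint.
Context {R : realType}.
Variables H K : hilbertType R.
Implicit Types A : bop H K.

(* [adj A] is the unique operator satisfying the adjoint identity; it exists
   by the Riesz representation theorem, so the default value 0 never occurs. *)
Definition adj A : bop K H :=
  xget 0 [set B : bop K H | forall x y, dotp (A x) y = dotp x (B y)].

Definition cont_invertible A : Prop :=
  exists B : bop K H, cancel A B /\ cancel B A.

(* The inverse operator; only meaningful when [cont_invertible A] holds. *)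
Definition binv A : bop K H :=
  xget 0 [set B : bop K H | cancel A B /\ cancel B A].

Definition opnorm A : R :=
  sup [set complex.Re `|A x| | x in [set x | `|x| <= 1]].

End Adjoint.

(* [corner S T A] is the operator iota_T^* A iota_S from S to T. *)
Definition corner (R : realType) (H : hilbertType R) (S T : closed_subspace H)
  (A : bop H H) : bop (subsp S) (subsp T) := adj (emb T) \ob A \ob emb S.

Section Pencils.
Context {R : realType}.
Variable H : hilbertType R.

Definition spectrum (A : bop H H) : set R[i] :=
  [set z | ~ cont_invertible (A - z *: bid H)].

Definition pencil (M0 M1 : bop H H) : R[i] -> bop H H :=
  fun z => z *: M0 + M1.

Implicit Type P : R[i] -> bop H H.

Definition pencil_spectrum P : set R[i] := [set z | spectrum (P z) 0].

Definition pencil_resolvent_set P : set R[i] := ~` pencil_spectrum P.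

Definition right_half_plane (nu : R) : set R[i] :=
  [set z | nu < complex.Re z].

Definition regular_pencil P : Prop :=
  exists nu : R, right_half_plane nu `<=` pencil_resolvent_set P /\
    exists c : R, forall z, right_half_plane nu z -> opnorm (binv (P z)) <= c.

End Pencils.

(* Main.v *)
Require Import Defs.
From HB Require Import structures.
From mathcomp Require Import all_boot all_order all_algebra complex.
From mathcomp Require Import all_classical all_reals all_analysis.
From mathcomp Require Import ring lra.

Import Order.TTheory GRing.Theory Num.Theory.
Import numFieldNormedType.Exports.

Local Open Scope classical_set_scope.
Local Open Scope ring_scope.

Set Implicit Arguments.
Unset Strict Implicit.
Unset Printing Implicit Defensive.

(** Split the domain as N(M0)^perp + N(M0) and the codomain as
    R(M0) + R(M0)^perp.  In these coordinates M0 has the single nonzero block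
    tM0, a bounded bijection.  As R(M0) is closed, tM0 acts between Hilbert
    spaces, so it is continuously invertible ([bounded_inverse]).  The pencil
    becomes
<<
      ( z tM0 + A   B )
      (     C       D )
>>
    with D the block of condition (ii).

    If D is invertible, eliminating B and C with the triangular factors V1 and
    V0 leaves the diagonal blocks z tM0 + tM1 (a Schur complement) and D
    ([pencil_factorization]).  All the outer factors are invertible, so M(z) is
    invertible exactly when z tM0 + tM1 is, i.e. when -z is not in the spectrum
    of tM0^-1 tM1 ([pencil_spectrumE]); a spectrum is closed and bounded, hence
    compact ([compact_spectrum]).  For large |z| the term z tM0 dominates tM1
    and bounds z tM0 + tM1 from below by 1; the other factors do not depend on
    z, so M(z) is bounded below uniformly, which is regularity
    ([cinv_corner_regular]).

    Conversely let the pencil be regular and let z be real and large.  The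
    first row of the equation M(z) u = y with y in R(M0)^perp forces the
    N(M0)^perp-component of u to be of order 1/z.  Up to an error of order 1/z
    the second row then reads D (P_N u) = y, so D has an approximate right
    inverse, and a Neumann series makes it exact; the same estimate shows that
    D is injective ([regular_cinv_corner]).

    Two general facts carry this.  The projection theorem identifies the
    adjoint of the embedding of a closed subspace with the orthogonal
    projection ([projection_theorem], [adj_embP], [orth_decomp]).  The bounded
    inverse theorem follows from Baire's theorem.  Baire's theorem and Banach's
    fixed point theorem are about spaces normed over the reals, whereas the
    norms here take their values in the complex numbers; [rnorm] and
    [realified] pass from one to the other. *)

(** * Real-valued norms *)

Section RealNorm.
Context {R : realType}.
Implicit Types V : normedModType R[i].

Definition rnorm V (x : V) : R := complex.Re `|x|.

Lemma rnormE V (x : V) : `|x| = (rnorm x)%:C%C.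
Proof. by rewrite /rnorm RRe_real// normr_real. Qed.

Lemma rnorm_ge0 V (x : V) : 0 <= rnorm x.
Proof. by rewrite -ler0c -rnormE. Qed.

Lemma rnorm_le V (W : normedModType R[i]) (x : V) (y : W) (c : R) :
  (`|x| <= c%:C%C * `|y|) = (rnorm x <= c * rnorm y).
Proof. by rewrite !rnormE -rmorphM lecR. Qed.

Lemma rnormD V (x y : V) : rnorm (x + y) <= rnorm x + rnorm y.
Proof. by rewrite -lecR rmorphD /= -!rnormE ler_normD. Qed.

Lemma rnormN V (x : V) : rnorm (- x) = rnorm x.
Proof. by rewrite /rnorm normrN. Qed.

Lemma rnormB V (x y : V) : rnorm (x - y) <= rnorm x + rnorm y.
Proof. by rewrite -(rnormN y) rnormD. Qed.

Lemma rnormZ V (a : R[i]) (x : V) : rnorm (a *: x) = rnorm a * rnorm x.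
Proof. by apply: complexI; rewrite rmorphM /= -!rnormE normrZ. Qed.

Lemma rnorm0 V : rnorm (0 : V) = 0.
Proof. by rewrite /rnorm normr0. Qed.

Lemma rnorm_eq0 V (x : V) : rnorm x <= 0 -> x = 0.
Proof.
by move=> x0; apply: normr0_eq0; rewrite rnormE; congr (_%:C)%C; apply/le_anti;
  rewrite x0 rnorm_ge0.
Qed.

Lemma rnormC (a : R) : rnorm (a%:C%C : R[i]) = `|a|.
Proof. by rewrite /rnorm normc_def/= expr0n addr0 sqrtr_sqr. Qed.

End RealNorm.

(** * Restriction of scalars to the reals *)

Section Realified.
Context {R : realType}.

(** An alias, so that the real structure does not compete with the complex one
    on the same carrier. *)
Definition realified (V : completeNormedModType R[i]) : Type := V.

Variable V : completeNormedModType R[i].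

HB.instance Definition _ := GRing.Zmodule.copy (realified V) V.

Let rscale (a : R) (x : realified V) : realified V := a%:C%C *: (x : V).

Let rscaleA a b x : rscale a (rscale b x) = rscale (a * b) x.
Proof. by rewrite /rscale scalerA rmorphM. Qed.
Let rscale1 : left_id 1 rscale.
Proof. by move=> x; rewrite /rscale scale1r. Qed.
Let rscaleDr : right_distributive rscale +%R.
Proof. by move=> a x y; rewrite /rscale scalerDr. Qed.
Let rscaleDl x : {morph rscale^~ x : a b / a + b}.
Proof. by move=> a b; rewrite /rscale rmorphD scalerDl. Qed.
HB.instance Definition _ := GRing.Zmodule_isLmodule.Build R (realified V)
  rscaleA rscale1 rscaleDr rscaleDl.

Let norm (x : realified V) : R := rnorm (x : V).
Let normD x y : norm (x + y) <= norm x + norm y.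
Proof. exact: rnormD. Qed.
Let normZ a x : norm (a *: x) = `|a| * norm x.
Proof. by rewrite /norm -rnormC -rnormZ. Qed.
Let norm0 x : norm x = 0 -> x = 0.
Proof. by move=> x0; apply: (@rnorm_eq0 _ V); rewrite -/(norm x) x0. Qed.

HB.instance Definition _ :=
  Lmodule_isNormed.Build R (realified V) normD normZ norm0.

Lemma realified_normE (x : realified V) : `|x| = rnorm (x : V).
Proof. by []. Qed.

Lemma realified_ballE (x : realified V) (e : R) :
  ball x e = ball (x : V) e%:C%C.
Proof.
apply/seteqP; split => y; rewrite -!ball_normE /= realified_normE -ltcR -rnormE.
all: by [].
Qed.

Let complete (F : set_system (realified V)) :
  ProperFilter F -> cauchy F -> cvg F.
Proof.
move=> FF /cauchy_ballP Fc.
have posE (e : R[i]) : 0 < e -> exists2 r : R, 0 < r & e = r%:C%C.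
  move=> e0; exists (complex.Re e); last by rewrite RRe_real// gtr0_real.
  by rewrite -ltcR RRe_real// gtr0_real.
have Gc : @cauchy V F.
  apply/cauchy_ballP => _ /posE[e e0 ->].
  apply: filterS (Fc e e0) => -[x y] /=.
  by rewrite realified_ballE.
have [l Gl] := (iffLR (cvg_ex _)) (@cauchy_cvg V _ _ Gc).
apply/cvg_ex; exists l.
apply/fcvg_ballP => e e0; rewrite realified_ballE.
by apply: (cvg_ball Gl); rewrite ltcR.
Qed.

HB.instance Definition _ := Uniform_isComplete.Build (realified V) complete.

Lemma realified_cvg (F : set_system V)
    (FF : Filter F) (l : V) :
  (F : set_system (realified V)) --> (l : realified V) -> F --> l.
Proof.
move=> Fl; apply/fcvg_ballP => e e0.
have eE : e = (complex.Re e)%:C%C by rewrite RRe_real// gtr0_real.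
rewrite eE -realified_ballE; apply: (cvg_ball Fl).
by rewrite -ltcR -eE.
Qed.

End Realified.

(** * Orthogonal projections *)

Section Projection.
Context {R : realType}.

Implicit Types H : hilbertType R.

Lemma dotpDr H (x y z : H) : dotp z (x + y) = dotp z x + dotp z y.
Proof. exact: linearDr. Qed.

Lemma dotpBr H (x y z : H) : dotp z (x - y) = dotp z x - dotp z y.
Proof. exact: linearBr. Qed.

Lemma dotpZr H a (x z : H) : dotp z (a *: x) = a^* * dotp z x.
Proof. exact: linearZr_LR. Qed.

Lemma dotpC H (x y : H) : dotp x y = (dotp y x)^*.
Proof. by rewrite hermC/= expr0 mul1r. Qed.

Lemma rnorm_sqr H (x : H) : (rnorm x ^+ 2)%:C%C = dotp x x.
Proof. by rewrite rmorphXn /= -rnormE sqr_normE. Qed.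

Lemma parallelogram H (x y : H) :
  rnorm (x + y) ^+ 2 + rnorm (x - y) ^+ 2 =
  (rnorm x ^+ 2 + rnorm y ^+ 2) *+ 2.
Proof.
apply: complexI; rewrite rmorphD [RHS]rmorphMn rmorphD /= !rnorm_sqr.
rewrite !linearDl /= !linearBr /= !linearDr /= !linearNl /=.
by ring.
Qed.

(** If u = x - l is not orthogonal to y, subtracting from u its component along
    y shortens it while l stays in S. *)
Lemma dist_min_orth H (S : closed_subspace H) (x l : H) : cs_set S l ->
  (forall s, cs_set S s -> rnorm (x - l) <= rnorm (x - s)) ->
  forall y, cs_set S y -> dotp (x - l) y = 0.
Proof.
move=> Sl lmin y Sy.
have [->|y0] := eqVneq y 0; first by rewrite linear0r.
have yy0 : 0 < dotp y y by exact: neq0_dnorm_gt0.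
set u := x - l; set a := dotp u y / dotp y y.
have vy : dotp (u - a *: y) y = 0.
  by rewrite linearBl/= linearZl_LR divfK ?subrr// gt_eqF.
have [S0 SP] := cs_submod S.
have Say : cs_set S (l + a *: y).
  have := SP a y l; rewrite !inE addrC; exact.
have := lmin _ Say; rewrite opprD addrA -/u.
rewrite -(@ler_sqr R) ?nnegrE ?rnorm_ge0// -lecR !rnorm_sqr.
have uE : u = (u - a *: y) + a *: y by rewrite subrK.
have -> : dotp u u = dotp (u - a *: y) (u - a *: y) + `|a| ^+ 2 * dotp y y.
  rewrite {1 2}uE hnormDd ?linearZr_LR/= ?vy ?mulr0//.
  by rewrite [dotp (a *: y) y]linearZl_LR/= mulrCA mulrA normCK.
rewrite -subr_ge0 opprD addNKr oppr_ge0 pmulr_lle0// => a0.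
have /eqP : `|a| ^+ 2 = 0 by apply/le_anti; rewrite a0 exprn_ge0.
rewrite sqrf_eq0 normr_eq0 mulf_eq0 invr_eq0 (gt_eqF yy0) orbF => /eqP.
by [].
Qed.

(** By the parallelogram identity a minimizing sequence for the distance to x is
    Cauchy, since midpoints stay in S; its limit is a nearest point. *)
Lemma projection_theorem H (S : closed_subspace H) (x : H) :
  exists2 l, cs_set S l & forall y, cs_set S y -> dotp (x - l) y = 0.
Proof.
have [S0 SP] := cs_submod S.
have S00 : cs_set S 0 by move: S0; rewrite inE.
have Smid y z : cs_set S y -> cs_set S z -> cs_set S (2^-1 *: (y + z)).
  move=> Sy Sz; have Syz : cs_set S (1 *: y + z) by move: (SP 1 y z); rewrite !inE; exact.
  have := SP 2^-1 (1 *: y + z) 0; rewrite !inE scale1r addr0.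
  by move=> /(_ _ S00); apply; rewrite -[y]scale1r.
pose D := [set rnorm (x - s) ^+ 2 | s in (S : set H)].
have D0 : D !=set0 by exists (rnorm (x - 0) ^+ 2), 0.
have lbD : has_lbound D by exists 0 => _ [s _ <-]; rewrite exprn_ge0// rnorm_ge0.
pose d := inf D.
have dP s : cs_set S s -> d <= rnorm (x - s) ^+ 2 by move=> Ss; apply: ge_inf => //; exists s.
have /choice[s sP] n : exists s, cs_set S s /\ rnorm (x - s) ^+ 2 < d + n.+1%:R^-1.
  have [_ [s Ss <-] sd] : exists2 e, D e & e < d + n.+1%:R^-1.
    exact: inf_adherent.
  by exists s.
have sdist n m : rnorm (s n - s m) ^+ 2 <= 2 * n.+1%:R^-1 + 2 * m.+1%:R^-1.
  have := parallelogram (x - s n) (x - s m).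
  have -> : x - s n - (x - s m) = - (s n - s m) by rewrite !opprB addrC addrA subrK.
  have -> : x - s n + (x - s m) = (2 : R[i]) *: (x - 2^-1 *: (s n + s m)).
    rewrite scalerBr scalerA divff// scale1r scaler_nat mulr2n opprD addrACA.
    by [].
  have := dP _ (Smid _ _ (sP n).1 (sP m).1).
  have -> : (2 : R[i]) = 2%:R%:C%C by rewrite rmorph_nat.
  rewrite rnormN rnormZ rnormC ger0_norm// exprMn.
  have := (sP n).2; have := (sP m).2.
  set A := rnorm _ ^+ 2; set B := rnorm _ ^+ 2; set C := rnorm _ ^+ 2; set E := rnorm _ ^+ 2.
  set p := _^-1; set q := _^-1.
  lra.
pose t : nat -> realified H := s.
have tc : cauchy (t @ \oo).
  apply: cauchy_exP => e e0.
  have [N Ne] : exists N, N.+1%:R^-1 < e ^+ 2 / 4.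
    exists (Num.truncn (e ^+ 2 / 4)^-1).
    by rewrite -ltf_pV2 ?(posrE,divr_gt0,exprn_gt0)// invrK truncnS_gt.
  exists (t N); exists N => // n /= Nn.
  rewrite -ball_normE /= realified_normE -ltr_sqr ?nnegrE ?rnorm_ge0 ?ltW//.
  apply: le_lt_trans (sdist N n) _.
  have : n.+1%:R^-1 <= N.+1%:R^-1 :> R by rewrite lef_pV2 ?posrE// ler_nat.
  by move: Ne; move: (N.+1%:R^-1) (n.+1%:R^-1) => p q; lra.
have [l tl] := (iffLR (cvg_ex _)) (@cauchy_cvg (realified H) _ _ tc).
have Sl : cs_set S l.
  have sl : s @ \oo --> (l : H) by apply: realified_cvg.
  apply: (closed_cvg _ (@cs_closed _ _ S) _ l sl).
  by apply: nearW => n; apply: (sP n).1.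
exists l => //; apply: dist_min_orth => // y Sy.
rewrite -ler_sqr ?nnegrE ?rnorm_ge0//; apply: le_trans (dP _ Sy).
have c1 : `|(x : realified H) - t n| ^+ 2 @[n --> \oo] --> `|(x : realified H) - l| ^+ 2.
  rewrite expr2; under eq_fun do rewrite expr2.
  by apply: cvgM; apply: cvg_norm; apply: cvgB => //; exact: cvg_cst.
have c2 : d + n.+1%:R^-1 @[n --> \oo] --> d.
  rewrite -[X in _ --> X]addr0; apply: cvgD; first exact: cvg_cst.
  exact: cvg_harmonic.
by apply: (ler_cvg_to c1 c2); apply: nearW => n; apply/ltW/(sP n).2.
Qed.

End Projection.

Section AdjointEmbedding.
Context {R : realType}.
Implicit Types H K : hilbertType R.

Lemma bop_ext H K (A B : bop H K) : A =1 B -> A = B.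
Proof. by move=> AB; apply: val_inj; apply: funext. Qed.

Lemma dotp_inj H (x y : H) : (forall z, dotp z x = dotp z y) -> x = y.
Proof.
move=> xy; apply/eqP; rewrite -subr_eq0; apply/negP => /negP xy0.
by have : 0 < dotp (x - y) (x - y) := neq0_dnorm_gt0 _ xy0; rewrite dotpBr xy subrr ltxx.
Qed.

Lemma adj_unique H K (A : bop H K) (B : bop K H) :
  (forall x y, dotp (A x) y = dotp x (B y)) -> adj A = B.
Proof.
move=> AB; apply: bop_ext => y; apply: dotp_inj => x.
pose P := [set B : bop K H | forall x y, dotp (A x) y = dotp x (B y)].
have /(_ x y) AE : P (adj A) by apply: (@xgetPex _ 0 P); exists B.
by rewrite -AB AE.
Qed.

Variables (H : hilbertType R) (S : closed_subspace H).

Lemma emb_in (s : subsp S) : cs_set S (emb S s).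
Proof. by case: s => s /= /set_mem. Qed.

Lemma emb_dotp (s t : subsp S) : dotp (emb S s) (emb S t) = dotp s t.
Proof. by []. Qed.

Lemma rnorm_emb (s : subsp S) : rnorm (emb S s) = rnorm s.
Proof. by []. Qed.

Lemma emb_inj : injective (emb S).
Proof. exact: val_inj. Qed.

Let ex_projection (x : H) :
  exists s : subsp S, forall t, dotp (emb S t) x = dotp t s.
Proof.
have [l Sl lP] := projection_theorem S x.
exists (Subsp (mem_set Sl)) => t; rewrite -emb_dotp.
apply/eqP; rewrite -subr_eq0 -dotpBr dotpC.
by rewrite lP ?conjC0//; exact: emb_in.
Qed.

(** [adj] is defined with a default value; this provides the adjoint identity
    for an embedding, the operator being the orthogonal projection. *)
Lemma adj_embP (t : subsp S) (x : H) : dotp (emb S t) x = dotp t (adj (emb S) x).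
Proof.
have [p pP] := choice ex_projection.
have lp : linear p.
  move=> a x' y; apply: dotp_inj => z.
  by rewrite dotpDr dotpZr -!pP dotpDr dotpZr.
have bp : exists c : R[i], forall x, `|p x| <= c * `|x|.
  exists 1 => y; rewrite mul1r.
  have [->|p0] := eqVneq (p y) 0; first by rewrite normr0.
  have n0 : 0 < `|p y| by rewrite normr_gt0.
  rewrite -(ler_pM2l n0) -expr2 sqr_normE -pP.
  have := dotp_CauchySchwarz (emb S (p y)) y.
  by rewrite ger0_norm// pP dnorm_ge0.
by rewrite (@adj_unique _ _ _ (mkbop lp bp))//; exact: pP.
Qed.

Lemma adj_emb_eq (s : subsp S) (x : H) :
  (forall t, dotp (emb S t) x = dotp t s) -> adj (emb S) x = s.
Proof. by move=> xs; apply: dotp_inj => t; rewrite -adj_embP. Qed.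

Lemma adj_embK : cancel (emb S) (adj (emb S)).
Proof. by move=> s; apply: adj_emb_eq. Qed.

Lemma adj_emb_le (x : H) : rnorm (adj (emb S) x) <= rnorm x.
Proof.
set p := adj (emb S) x; rewrite -lecR -!rnormE.
have [->|p0] := eqVneq p 0; first by rewrite normr0.
have n0 : 0 < `|p| by rewrite normr_gt0.
rewrite -(ler_pM2l n0) -expr2 sqr_normE -adj_embP.
have := dotp_CauchySchwarz (emb S p) x.
by rewrite ger0_norm// adj_embP dnorm_ge0.
Qed.

End AdjointEmbedding.

Section OrthogonalDecomposition.
Context {R : realType} (H : hilbertType R) (S : closed_subspace H).
Let So := orth S.

Lemma emb_orth (s : subsp S) (t : subsp So) : dotp (emb S s) (emb So t) = 0.
Proof.
have st : forall y, cs_set S y -> dotp (emb So t) y = 0 := emb_in t.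
by rewrite dotpC st ?conjC0//; exact: emb_in.
Qed.

Lemma adj_emb_orthl (t : subsp So) : adj (emb S) (emb So t) = 0.
Proof. by apply: adj_emb_eq => s; rewrite emb_orth linear0r. Qed.

Lemma adj_emb_orthr (s : subsp S) : adj (emb So) (emb S s) = 0.
Proof.
by apply: adj_emb_eq => t; rewrite dotpC emb_orth conjC0 linear0r.
Qed.

Lemma orth_decomp (x : H) :
  x = emb S (adj (emb S) x) + emb So (adj (emb So) x).
Proof.
have So_x : cs_set So (x - emb S (adj (emb S) x)).
  move=> y Sy; rewrite dotpC dotpBr.
  have -> : y = emb S (Subsp (mem_set Sy)) by [].
  by rewrite adj_embP emb_dotp subrr conjC0.
pose t : subsp So := Subsp (mem_set So_x).
have xE : x = emb S (adj (emb S) x) + emb So t by rewrite addrC subrK.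
rewrite (_ : adj (emb So) x = t)//; apply: adj_emb_eq => s.
by rewrite {1}xE dotpDr [dotp _ (emb S _)]dotpC emb_orth conjC0 add0r.
Qed.

(** The pair of orthogonal projections is a unitary map onto the direct sum, so
    its adjoint is its inverse, which adds the two components. *)
Lemma adj_bcol_emb :
  adj (bcol (adj (emb S)) (adj (emb So))) =1 (fun y => emb S y.1 + emb So y.2).
Proof.
have lf : linear (fun y : dsum (subsp S) (subsp So) => emb S y.1 + emb So y.2).
  by move=> a x y; rewrite !linearP/= scalerDr addrACA.
have bf : exists c : R[i], forall y : dsum (subsp S) (subsp So),
    `|emb S y.1 + emb So y.2| <= c * `|y|.
  exists 2 => y; apply: le_trans (ler_normD _ _) _.
  by rewrite mulr_natl mulr2n; apply: lerD; [exact: dsum_norm1_le|exact: dsum_norm2_le].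
move=> y; rewrite (@adj_unique _ _ _ _ (mkbop lf bf))//= => x z.
rewrite dotpDr.
by congr (_ + _); rewrite [RHS]dotpC;
  [rewrite (adj_embP z.1 x : dotp (subsp_val z.1) x = _)
  |rewrite (adj_embP z.2 x : dotp (subsp_val z.2) x = _)]; rewrite -dotpC.
Qed.

End OrthogonalDecomposition.

(** * Continuously invertible operators *)

Section Invertibility.
Context {R : realType}.
Implicit Types H K L : hilbertType R.

Lemma bopD H K (A : bop H K) x y : A (x + y) = A x + A y.
Proof. exact: linearD. Qed.

Lemma bopB H K (A : bop H K) x y : A (x - y) = A x - A y.
Proof. exact: linearB. Qed.

Lemma bopN H K (A : bop H K) x : A (- x) = - A x.
Proof. exact: linearN. Qed.

Lemma bopZ H K (A : bop H K) a x : A (a *: x) = a *: A x.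
Proof. exact: linearZ. Qed.

Lemma bop0 H K (A : bop H K) : A 0 = 0.
Proof. exact: linear0. Qed.

Lemma bop_rnorm H K (A : bop H K) :
  exists2 c : R, 0 <= c & forall x, rnorm (A x) <= c * rnorm x.
Proof.
have [c c0 Ac] := bop_bounded A.
have cE : c = (complex.Re c)%:C%C by rewrite RRe_real// ger0_real.
exists (complex.Re c); first by rewrite -ler0c -cE.
by move=> x; rewrite -rnorm_le -cE.
Qed.

Lemma binvP H K (A : bop H K) : cont_invertible A ->
  cancel A (binv A) /\ cancel (binv A) A.
Proof.
move=> [B AB]; pose P := [set B : bop K H | cancel A B /\ cancel B A].
by have : P (binv A) by apply: (@xgetPex _ 0 P); exists B.
Qed.

Definition bounded_below H K (A : bop H K) (c : R) :=
  forall x, rnorm x <= c * rnorm (A x).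

Lemma cinv_bounded_below H K (A : bop H K) : cont_invertible A ->
  exists2 c : R, 0 <= c & bounded_below A c.
Proof.
move=> [B [AB BA]]; have [c c0 Bc] := bop_rnorm B.
by exists c => // x; rewrite -{1}[x]AB.
Qed.

Lemma bounded_below_inj H K (A : bop H K) c : bounded_below A c -> injective A.
Proof.
move=> Ac x y Axy; apply/eqP; rewrite -subr_eq0; apply/eqP/rnorm_eq0.
by apply: le_trans (Ac _) _; rewrite linearB/= Axy subrr rnorm0 mulr0.
Qed.

Lemma bounded_below_surj_cinv H K (A : bop H K) (c : R) : bounded_below A c ->
  (forall y, exists x, A x = y) -> cont_invertible A.
Proof.
move=> Ac /choice[B BA]; have Ainj := bounded_below_inj Ac.
have lB : linear B by move=> a x y; apply: Ainj; rewrite linearP/= !BA.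
have bB : exists c : R[i], forall x, `|B x| <= c * `|x|.
  by exists c%:C%C => x; rewrite rnorm_le -{2}[x]BA.
exists (mkbop lB bB); split => x /=; last exact: BA.
by apply: Ainj; rewrite BA.
Qed.

Lemma cinv_comp H K L (A : bop K L) (B : bop H K) :
  cont_invertible A -> cont_invertible B -> cont_invertible (A \ob B).
Proof.
move=> [A' [AA' A'A]] [B' [BB' B'B]]; exists (B' \ob A').
by split => x /=; rewrite ?AA' ?BB' ?B'B ?A'A.
Qed.

Lemma cinv_compl H K L (A : bop K L) (B : bop H K) :
  cont_invertible A -> cont_invertible (A \ob B) -> cont_invertible B.
Proof.
move=> [A' [AA' A'A]] /(@cinv_comp _ _ _ A' _).
have -> : A' \ob (A \ob B) = B by apply: bop_ext => x /=; rewrite AA'.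
by apply; exists A.
Qed.

Lemma cinv_compr H K L (A : bop K L) (B : bop H K) :
  cont_invertible B -> cont_invertible (A \ob B) -> cont_invertible A.
Proof.
move=> [B' [BB' B'B]] /(@cinv_comp _ _ _ _ B').
have -> : (A \ob B) \ob B' = A by apply: bop_ext => x /=; rewrite B'B.
by apply; exists B.
Qed.

Lemma bounded_below_comp H K L (A : bop K L) (B : bop H K) (a b : R) : 0 <= b ->
  bounded_below A a -> bounded_below B b -> bounded_below (A \ob B) (b * a).
Proof.
move=> b0 Aa Bb x; by apply: (le_trans (Bb x)); rewrite -mulrA; apply: ler_wpM2l => //; exact: Aa.
Qed.

Lemma cinv_scale H K (A : bop H K) (z : R[i]) : z != 0 ->
  cont_invertible A -> cont_invertible (z *: A).
Proof.
move=> z0 [B [AB BA]]; exists (z^-1 *: B); split => x.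
  have -> : (z^-1 *: B) ((z *: A) x) = z^-1 *: B (z *: A x) by [].
  by rewrite linearZ/= scalerA mulVf// scale1r AB.
have -> : (z *: A) ((z^-1 *: B) x) = z *: A (z^-1 *: B x) by [].
by rewrite linearZ/= scalerA mulfV// scale1r BA.
Qed.

Lemma cinv_opp H K (A : bop H K) :
  cont_invertible (- A) <-> cont_invertible A.
Proof.
have N B : cont_invertible B -> cont_invertible (- B : bop H K).
  by rewrite -scaleN1r; apply: cinv_scale; rewrite oppr_eq0 oner_eq0.
by split => /N//; rewrite opprK.
Qed.

(** Neumann's theorem: x + E x = y is solved by the fixed point of the
    contraction x |-> y - E x. *)
Lemma cinv_id_add H (E : bop H H) (q : R) : 0 <= q -> q < 1 ->
  (forall x, rnorm (E x) <= q * rnorm x) -> cont_invertible (bid H + E).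
Proof.
move=> q0 q1 Eq.
have EE x : (bid H + E) x = x + E x by [].
apply: (@bounded_below_surj_cinv _ _ _ (1 - q)^-1).
  move=> x; rewrite mulrC ler_pdivlMr ?subr_gt0// EE.
  have : rnorm x <= rnorm (x + E x) + rnorm (E x).
    by rewrite -{1}[x](addrK (E x)); exact: rnormB.
  by have := Eq x; lra.
move=> y.
pose f (x : realified H) : realified H := (y : realified H) - E x.
have fP : {homo f : x / setT x >-> setT x} by [].
pose F : {fun [set: realified H] >-> [set: realified H]} :=
  HB.pack f (isFun.Build _ _ _ _ f fP).
have [|||p _ pE] := @banach_fixed_point R (realified H) setT F.
- exists (NngNum q0); split => //= -[x z] _ /=.
  rewrite /f opprB addrC addrA subrK realified_normE.
  rewrite -linearB/= -[`|_|]rnormN opprB.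
  exact: Eq.
- exact: closedT.
- by exists 0.
by exists p; rewrite EE {1}pE /= /f subrK.
Qed.

(** With a bound k for the inverse of A, the sum is A (1 + A^-1 B) and A^-1 B has
    norm at most k q. *)
Lemma cinv_add H K (A B : bop H K) (k q : R) : 0 <= q -> k * q < 1 ->
  0 <= k -> cont_invertible A -> bounded_below A k ->
  (forall x, rnorm (B x) <= q * rnorm x) -> cont_invertible (A + B).
Proof.
move=> q0 kq k0 cA Ak Bq; have [AV VA] := binvP cA.
have -> : A + B = A \ob (bid H + binv A \ob B).
  apply: bop_ext => x.
  have -> : (A \ob (bid H + binv A \ob B)) x = A (x + binv A (B x)) by [].
  by rewrite linearD/= VA.
apply: cinv_comp => //; apply: (@cinv_id_add _ _ (k * q)) => //.
  exact: mulr_ge0.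
move=> x; apply: le_trans (Ak _) _ => /=; rewrite VA -mulrA ler_wpM2l//.
Qed.

End Invertibility.

(** * The bounded inverse theorem *)

Section BoundedInverse.
Context {R : realType}.
Variables (H K : hilbertType R) (A : bop H K).

Lemma bop_realified_cvg (u : nat -> realified H) (l : realified H) :
  u @ \oo --> l -> ((A : H -> K) \o u : nat -> realified K) @ \oo --> (A l : realified K).
Proof.
have [c c0 Ac] := bop_rnorm A.
move=> /cvgrPdist_lt ul; apply/cvgrPdist_lt => e e0.
have c1 : 0 < c + 1 by lra.
apply: filterS (ul (e / (c + 1)) (divr_gt0 e0 c1)) => n /=.
rewrite ltr_pdivlMr// !realified_normE => lu; rewrite -linearB.
apply: le_lt_trans (Ac _) _; apply: le_lt_trans lu; rewrite mulrC.
by rewrite ler_wpM2l ?rnorm_ge0//; lra.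
Qed.

Hypothesis Asurj : forall y, exists x, A x = y.

Let image_ball (n : nat) : set (realified K) :=
  [set A x | x in [set x : H | rnorm x <= n%:R]].

(** The images of the balls cover K, so by Baire one of them is dense in some
    ball. *)
Let image_ball_somewhere_dense : exists n (y0 : K) (r : R), 0 < r /\
  forall y, rnorm y < r -> closure (image_ball n) (y0 + y).
Proof.
pose F n := ~` closure (image_ball n).
have [Fd|] := pselect (forall n, dense (F n)).
  have oF n : open (F n) by apply: closed_openC; exact: closed_closure.
  have [] := @Baire _ (realified K) F (fun n => conj (oF n) (Fd n)) setT _ openT.
    exact: (ex_intro _ (0 : realified K) Logic.I).
  move=> y [_ Fy]; have [x xy] := Asurj y.
  have := Fy (Num.truncn (rnorm x)).+1 Logic.I; case; apply: subset_closure.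
  by exists x => //=; apply/ltW; exact: truncnS_gt.
move=> /existsNP[n /denseNE[U [[y0 [oU Uy0]] UF]]]; exists n, y0.
have /nbhs_ballP[r /= r0 rU] : nbhs y0 U by exact: open_nbhs_nbhs.
exists r; split => // y yr; apply: contrapT => Fy.
suff : set0 (y0 + y : realified K) by [].
rewrite -UF; split => //; apply: rU.
by rewrite -ball_normE /= realified_normE opprD addNKr rnormN.
Qed.

(** Differences of points of the ball where the images are dense give density
    near the origin; scaling turns this into approximate solutions of A x = y,
    of norm controlled by that of y and with half of y as error. *)
Let approx_solution :
  exists2 M : R, 0 <= M & forall y, exists x,
    rnorm x <= M * rnorm y /\ rnorm (y - A x) <= rnorm y / 2.
Proof.
have [n [y0 [r [r0 yr]]]] := image_ball_somewhere_dense.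
have near0 y e : 0 < e -> rnorm y < r -> exists x,
    rnorm x <= 2 * n%:R /\ rnorm (y - A x) < e.
  move=> e0 /yr cy.
  have c0 : closure (image_ball n) (y0 + 0) by apply: yr; rewrite rnorm0.
  have e2 : 0 < e / 2 by rewrite divr_gt0.
  have [_ [[x1 x1n <-]]] := cy _ (nbhsx_ballx _ _ e2).
  have [_ [[x2 x2n <-]]] := c0 _ (nbhsx_ballx _ _ e2).
  rewrite -!ball_normE /= !realified_normE addr0 => yx2 yx1.
  exists (x1 - x2); split.
    by apply: le_trans (rnormB _ _) _; move: x1n x2n => /=; lra.
  rewrite linearB/= (_ : _ - _ = (y0 + y - A x1) - (y0 - A x2)).
    by apply: le_lt_trans (rnormB _ _) _; lra.
  by rewrite !opprB [RHS]addrC -[y0 + y - _]addrA addrA subrK addrCA.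
exists (4 * n%:R / r); first by rewrite divr_ge0// ?mulr_ge0// ltW.
move=> y; have [->|y0'] := eqVneq y 0.
  by exists 0; rewrite linear0 subrr !rnorm0 mulr0 mul0r.
have ny : 0 < rnorm y.
  by rewrite lt_neqAle rnorm_ge0 andbT eq_sym; apply: contra_neq y0' => y00;
    apply: rnorm_eq0; rewrite y00.
pose t := r / (2 * rnorm y).
have t0 : 0 < t by rewrite divr_gt0// mulr_gt0.
have tC : t%:C%C != 0 :> R[i] by rewrite fmorph_eq0 gt_eqF.
have [||x [xn yx]] := near0 (t%:C%C *: y) (r / 4).
- by rewrite divr_gt0.
- rewrite rnormZ rnormC gtr0_norm// /t; have -> : r / (2 * rnorm y) * rnorm y = r / 2.
    by field; rewrite gt_eqF.
  lra.
have tV : (t^-1)%:C%C = (t%:C%C)^-1 :> R[i] by rewrite fmorphV.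
have tN : `|t^-1| = 2 * rnorm y / r.
  by rewrite ger0_norm ?invr_ge0 ?ltW// /t invfM invrK; field; rewrite !gt_eqF.
exists ((t^-1)%:C%C *: x); split.
  rewrite rnormZ rnormC tN.
  have -> : 4 * n%:R / r * rnorm y = 2 * rnorm y / r * (2 * n%:R).
    by field; rewrite gt_eqF.
  by apply: ler_wpM2l => //; rewrite divr_ge0 ?mulr_ge0 ?ltW.
have -> : y - A ((t^-1)%:C%C *: x) = (t^-1)%:C%C *: (t%:C%C *: y - A x).
  by rewrite scalerBr linearZ/= scalerA tV mulVf// scale1r.
rewrite rnormZ rnormC tN.
have -> : rnorm y / 2 = 2 * rnorm y / r * (r / 4) by field; rewrite gt_eqF.
by apply: ler_wpM2l; [rewrite divr_ge0 ?mulr_ge0 ?ltW|exact: ltW].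
Qed.

(** Solving approximately for the successive errors, which decrease
    geometrically, and summing gives an exact solution. *)
Lemma bounded_preimage : exists2 M : R, 0 <= M &
  forall y, exists2 x, A x = y & rnorm x <= M * rnorm y.
Proof.
have [M M0 /choice[g gP]] := approx_solution.
exists (2 * M); first by rewrite mulr_ge0.
move=> y.
pose v := fix v n := if n is m.+1 then v m - A (g (v m)) else y.
have vS n : v n.+1 = v n - A (g (v n)) by [].
have v_le n : rnorm (v n) <= rnorm y * 2^-1 ^+ n.
  elim: n => [|n ih]; first by rewrite expr0 mulr1.
  by rewrite vS exprSr; apply: le_trans (gP _).2 _; lra.
pose u : nat -> realified H := fun n => g (v n).
have u_le n : `|u n| <= M * rnorm y * 2^-1 ^+ n.
  by rewrite -mulrA; apply: le_trans (gP _).1 _; rewrite ler_wpM2l.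
have half1 : `|2^-1 : R| < 1 by rewrite ger0_norm//; lra.
have cu : cvgn (series u).
  apply: normed_cvg; apply: (@series_le_cvg _ _ (geometric (M * rnorm y) 2^-1)) => //.
  - by move=> n /=.
  - by move=> n /=; rewrite mulr_ge0 ?exprn_ge0// mulr_ge0 ?rnorm_ge0.
  - exact: is_cvg_geometric_series.
have [x ux] := (iffLR (cvg_ex _)) cu.
have Au n : A (series u n) = y - v n.
  elim: n => [|n ih]; first by rewrite /series/= big_geq// linear0 subrr.
  by rewrite vS seriesSr linearD /= ih opprB [A _ - v n]addrC addrA.
exists x.
  have c1 := bop_realified_cvg ux.
  have c2 : ((A : H -> K) \o series u : nat -> realified K) @ \oo --> (y : realified K).
    apply/cvgrPdist_lt => e e0.
    have /cvgrPdist_lt/(_ e e0) := @cvg_geometric R (rnorm y) _ half1.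
    apply: filterS => n; rewrite /= Au sub0r normrN realified_normE opprB addrC subrK.
    by apply: le_lt_trans; apply: le_trans (v_le n) (ler_norm _).
  exact: (cvg_unique _ c1 c2).
rewrite -realified_normE.
apply: (ler_cvg_to (cvg_norm ux) (cvg_cst _)); apply: nearW => n.
have : `|series u n| <= 2 * M * rnorm y * (1 - 2^-1 ^+ n).
  elim: n => [|n ih]; first by rewrite /series/= big_geq// normr0 expr0 subrr mulr0.
  rewrite seriesSr; apply: le_trans (ler_normD _ _) _.
  have := u_le n; rewrite exprSr; move: ih.
  move: (`|_|) (`|_|) (_ ^+ _) => a b c; lra.
move/le_trans; apply; rewrite ler_piMr ?mulr_ge0 ?rnorm_ge0//.
Qed.

End BoundedInverse.

Lemma bounded_inverse (R : realType) (H K : hilbertType R) (A : bop H K) :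
  injective A -> (forall y, exists x, A x = y) -> cont_invertible A.
Proof.
move=> Ainj Asurj; have [M M0 AM] := bounded_preimage Asurj.
apply: (@bounded_below_surj_cinv _ _ _ _ M) => // x.
by have [x' /Ainj ->] := AM (A x).
Qed.

(** * Compactness of the spectrum *)

Section Spectrum.
Context {R : realType}.

Lemma rnorm_scalar_le (z : R[i]) :
  `|complex.Re z| <= rnorm z /\ `|complex.Im z| <= rnorm z.
Proof.
rewrite /rnorm normc_def /=; split; rewrite -sqrtr_sqr ler_wsqrtr//.
  by rewrite lerDl sqr_ge0.
by rewrite lerDr sqr_ge0.
Qed.

Lemma rnorm_mk (a b : R) : rnorm ((a +i* b)%C : R[i]) <= `|a| + `|b|.
Proof.
rewrite /rnorm normc_def /= -ler_sqr ?nnegrE ?addr_ge0 ?sqrtr_ge0//.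
rewrite sqr_sqrtr ?addr_ge0 ?sqr_ge0// sqrrD !real_normK ?num_real//.
by rewrite addrAC lerDl mulrn_wge0 ?mulr_ge0.
Qed.

(** Heine-Borel in the complex plane, seen as the continuous image of the real
    plane. *)
Lemma bounded_closed_complex_compact (A : set R[i]) (r : R) :
  closed A -> (forall z, A z -> rnorm z <= r) -> compact A.
Proof.
move=> clA Ar; pose f (p : R * R) : R[i] := (p.1 +i* p.2)%C.
have cf : continuous f.
  move=> [a b]; apply/cvgrPdist_lt => e e0.
  have eE : e = (complex.Re e)%:C%C by rewrite RRe_real// gtr0_real.
  have e1 : 0 < complex.Re e / 2 by rewrite divr_gt0// -ltcR -eE.
  exists (ball a (complex.Re e / 2), ball b (complex.Re e / 2)).
    by split; apply: nbhsx_ballx.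
  move=> [x y] [/=]; rewrite -!ball_normE /= => ax byy.
  rewrite eE rnormE ltcR (_ : _ - _ = ((a - x) +i* (b - y))%C)//.
  by apply: le_lt_trans (rnorm_mk _ _) _; lra.
apply: (subclosed_compact clA (B := f @` (`[- r, r] `*` `[- r, r]))).
  apply: continuous_compact; first exact: continuous_subspaceT.
  by apply: compact_setX; exact: segment_compact.
move=> z /Ar zr; exists (complex.Re z, complex.Im z); last by case: {zr} z.
have [rez imz] := rnorm_scalar_le z.
by split; rewrite /= in_itv /= -ler_norml; [apply: le_trans rez _|apply: le_trans imz _].
Qed.

(** Both closedness and boundedness are instances of [cinv_add]: perturb A - z by
    (z - w) for w close to z, and - z by A for z larger than the norm of A. *)
Lemma compact_spectrum (H : hilbertType R) (A : bop H H) : compact (spectrum A).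
Proof.
have [c c0 Ac] := bop_rnorm A.
have id_inv : cont_invertible (bid H) by exists (bid H).
apply: (@bounded_closed_complex_compact _ c).
  rewrite -[spectrum A]setCK; apply: open_closedC.
  rewrite openE => z /= /contrapT Az; have [k k0 Ak] := cinv_bounded_below Az.
  have e0 : 0 < (k + 1)^-1 by rewrite invr_gt0; lra.
  have eC0 : 0 < ((k + 1)^-1)%:C%C :> R[i].
    by rewrite -[0]/(0%:C)%C ltcR.
  apply/nbhs_ballP; exists ((k + 1)^-1)%:C%C => // w.
  rewrite -ball_normE /= rnormE ltcR => zw nAw; apply: nAw.
  have -> : A - w *: bid H = (A - z *: bid H) + (z - w) *: bid H.
    by rewrite scalerBl addrA subrK.
  apply: (@cinv_add _ _ _ _ _ k (rnorm (z - w))) => //.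
  - exact: rnorm_ge0.
  - have : k * rnorm (z - w) <= k * (k + 1)^-1 by apply: ler_wpM2l => //; exact: ltW.
    move/le_lt_trans; apply; rewrite ltr_pdivrMr; lra.
  - by move=> x; rewrite -rnormZ.
move=> z Az; rewrite leNgt; apply/negP => cz; apply: Az.
have z0 : z != 0 by apply: contraTneq cz => ->; rewrite rnorm0 -leNgt.
have nz : 0 < rnorm z by exact: le_lt_trans cz.
rewrite addrC -scaleNr; apply: (@cinv_add _ _ _ _ _ (rnorm z)^-1 c) => //.
- by rewrite mulrC ltr_pdivrMr// mul1r.
- by rewrite invr_ge0 ltW.
- by apply: cinv_scale => //; rewrite oppr_eq0.
- move=> x; have -> : (- z *: bid H) x = - z *: x by [].
  by rewrite rnormZ rnormN mulrA mulVf ?mul1r// gt_eqF.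
Qed.

End Spectrum.

(** * Operator norm *)

Section OpNorm.
Context {R : realType} (H K : hilbertType R).
Implicit Types A : bop H K.

Lemma opnorm_le A (c : R) : 0 <= c ->
  (forall x, rnorm (A x) <= c * rnorm x) -> opnorm A <= c.
Proof.
move=> c0 Ac; apply: ge_sup.
  by exists (complex.Re `|A 0|), 0 => //=; rewrite normr0 ler01.
move=> _ [x /= x1 <-]; apply: le_trans (Ac x) _.
by rewrite ler_piMr// -lecR -rnormE.
Qed.

Lemma rnorm_opnorm A x : rnorm (A x) <= opnorm A * rnorm x.
Proof.
have [c c0 Ac] := bop_rnorm A.
have hs : has_sup [set complex.Re `|A x| | x in [set x | `|x| <= 1]].
  split; first by exists (complex.Re `|A 0|), 0 => //=; rewrite normr0 ler01.
  exists c => _ [y /= y1 <-]; apply: le_trans (Ac y) _.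
  by rewrite ler_piMr// -lecR -rnormE.
have [->|x0] := eqVneq x 0; first by rewrite linear0 !rnorm0 mulr0.
have nx : 0 < rnorm x.
  by rewrite lt_neqAle rnorm_ge0 andbT eq_sym; apply: contra_neq x0 => x00;
    apply: rnorm_eq0; rewrite x00.
rewrite -ler_pdivrMr// mulrC.
have -> : (rnorm x)^-1 * rnorm (A x) = rnorm (A (((rnorm x)^-1)%:C%C *: x)).
  by rewrite linearZ/= rnormZ rnormC ger0_norm// invr_ge0 rnorm_ge0.
apply: (sup_upper_bound hs); exists (((rnorm x)^-1)%:C%C *: x) => //=.
rewrite rnormE rnormZ rnormC ger0_norm ?invr_ge0 ?rnorm_ge0// mulVf ?gt_eqF//.
Qed.

End OpNorm.

(** * Block operators *)

Section Blocks.
Context {R : realType}.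

Lemma rnorm_dsum_le (H K : hilbertType R) (x : dsum H K) :
  rnorm x <= rnorm x.1 + rnorm x.2.
Proof. by rewrite -lecR rmorphD /= -!rnormE dsum_norm_le. Qed.

Lemma rnorm_dsum1 (H K : hilbertType R) (x : dsum H K) : rnorm x.1 <= rnorm x.
Proof. by rewrite -lecR -!rnormE dsum_norm1_le. Qed.

Lemma rnorm_dsum2 (H K : hilbertType R) (x : dsum H K) : rnorm x.2 <= rnorm x.
Proof. by rewrite -lecR -!rnormE dsum_norm2_le. Qed.

Variables (H1 H2 K1 K2 : hilbertType R).

Lemma bounded_below_diag (A : bop H1 K1) (D : bop H2 K2) (a d : R) :
  0 <= a -> 0 <= d -> bounded_below A a -> bounded_below D d ->
  bounded_below (bblock A 0 0 D) (a + d).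
Proof.
move=> a0 d0 Aa Dd x; apply: le_trans (rnorm_dsum_le x) _.
have -> : bblock A 0 0 D x = (A x.1 + 0, 0 + D x.2) :> dsum K1 K2 by [].
rewrite addr0 add0r mulrDl; apply: lerD.
  apply: le_trans (Aa _) _; apply: ler_wpM2l => //.
  exact: (rnorm_dsum1 ((A x.1, D x.2) : dsum K1 K2)).
apply: le_trans (Dd _) _; apply: ler_wpM2l => //.
exact: (rnorm_dsum2 ((A x.1, D x.2) : dsum K1 K2)).
Qed.

Lemma bblockE (A : bop H1 K1) (B : bop H2 K1) (C : bop H1 K2) (D : bop H2 K2) x y :
  bblock A B C D (x, y) = (A x + B y, C x + D y).
Proof. by []. Qed.

Lemma bop0E (x : H1) : (0 : bop H1 K1) x = 0.
Proof. by []. Qed.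

Lemma bopNE (A : bop H1 K1) (x : H1) : (- A) x = - A x.
Proof. by []. Qed.

End Blocks.

Section BlockInverse.
Context {R : realType}.
Variables (H1 H2 K1 K2 : hilbertType R).

Lemma cinv_diag (A : bop H1 K1) (D : bop H2 K2) : cont_invertible D ->
  cont_invertible (bblock A 0 0 D) <-> cont_invertible A.
Proof.
move=> [D' [DD' D'D]]; split; last first.
  move=> [A' [AA' A'A]]; exists (bblock A' 0 0 D').
  by split=> -[x y]; rewrite !bblockE !bop0E !(addr0, add0r) ?AA' ?DD' ?A'A ?D'D.
move=> iAD; have [E [_ EAD]] := iAD; have [k k0 ADk] := cinv_bounded_below iAD.
apply: (@bounded_below_surj_cinv _ _ _ _ k) => [x|y].
  apply: le_trans (rnorm_dsum1 ((x, 0) : dsum H1 H2)) _.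
  apply: le_trans (ADk _) _; apply: ler_wpM2l => //.
  apply: le_trans (rnorm_dsum_le _) _.
  by rewrite bblockE !bop0E linear0 !addr0 /= rnorm0 addr0.
exists (E (y, 0)).1; have := EAD (y, 0).
by case: (E (y, 0)) => u v; rewrite bblockE bop0E addr0 => -[].
Qed.

Lemma cinv_lower (C : bop H1 H2) :
  cont_invertible (bblock (bid H1) 0 C (bid H2)).
Proof.
exists (bblock (bid H1) 0 (- C) (bid H2)).
by split => -[x y]; rewrite !bblockE !bop0E !addr0 bopNE /= ?addKr ?addNKr.
Qed.

Lemma cinv_upper (B : bop H2 H1) :
  cont_invertible (bblock (bid H1) B 0 (bid H2)).
Proof.
exists (bblock (bid H1) (- B) 0 (bid H2)).
by split => -[x y]; rewrite !bblockE !bop0E !add0r bopNE /= ?addrK ?subrK.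
Qed.

End BlockInverse.

(** * The pencil in block form *)

Section Proposition.
Context {R : realType} (H : hilbertType R) (M0 M1 : bop H H).
Hypothesis clR : closed (range M0).

Let N := ker M0.
Let Np := orth N.
Let Rg := ran clR.
Let Rgp := orth Rg.
Let D := corner N Rgp M1.
Let tM0 := corner Np Rg M0.

Lemma M0_emb_ker n : M0 (emb N n) = 0.
Proof. exact: (emb_in n). Qed.

Lemma M0_proj x : M0 (emb Np (adj (emb Np) x)) = M0 x.
Proof. by rewrite {2}(orth_decomp N x) bopD M0_emb_ker add0r. Qed.

Lemma emb_tM0 w : emb Rg (tM0 w) = M0 (emb Np w).
Proof.
have MR : cs_set Rg (M0 (emb Np w)) by exists (emb Np w).
have -> : M0 (emb Np w) = emb Rg (Subsp (mem_set MR)) by [].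
rewrite /tM0 /corner; congr (emb Rg _); apply: adj_emb_eq => t.
by [].
Qed.

(** tM0 is injective since N(M0) meets its orthogonal complement in 0 only, and
    onto since M0 only sees the component of its argument in N(M0)^perp. *)
Lemma cinv_tM0 : cont_invertible tM0.
Proof.
apply: bounded_inverse => [w w' tw|y].
  have Mw : M0 (emb Np (w - w')) = 0.
    by rewrite -emb_tM0 bopB tw subrr bop0.
  pose n : subsp N := Subsp (mem_set Mw).
  apply/eqP; rewrite -subr_eq0; apply/eqP; apply: dotp_inj => z.
  rewrite linear0r -emb_dotp.
  have -> : emb Np (w - w') = emb N n by [].
  by rewrite dotpC emb_orth conjC0.
have [x _ xy] := emb_in y; exists (adj (emb Np) x).
by apply: emb_inj; rewrite emb_tM0 M0_proj xy.
Qed.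

Lemma adj_emb_ran_orth_M0 x : adj (emb Rgp) (M0 x) = 0.
Proof. by rewrite -M0_proj -emb_tM0 adj_emb_orthr. Qed.

Lemma pencilE z x : pencil M0 M1 z x = z *: M0 x + M1 x.
Proof. by []. Qed.

Lemma resolvent_setP z :
  pencil_resolvent_set (pencil M0 M1) z <-> cont_invertible (pencil M0 M1 z).
Proof.
rewrite /pencil_resolvent_set /pencil_spectrum /spectrum /= scale0r subr0.
by split => [/contrapT|zM /(_ zM)].
Qed.

(** * Regularity implies invertibility of the corner *)

Section Regular.
Hypothesis reg : regular_pencil (pencil M0 M1).

Lemma regular_cinv_corner : cont_invertible D.
Proof.
have [nu [res [c0 opc]]] := reg.
pose c := Num.max c0 0.
have c_ge0 : 0 <= c by rewrite le_max lexx orbT.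
have [k k0 tk] := cinv_bounded_below cinv_tM0.
have [m m_ge0 Mm] := bop_rnorm M1.
(* Both estimates below have an error of at most q / r, so r > 2 q suffices. *)
pose q : R := (c * m + 1) * k * m.
have q0 : 0 <= q by rewrite !mulr_ge0// addr_ge0// mulr_ge0.
pose r : R := Num.max nu 0 + 2 * q + 1.
have nu_max : nu <= Num.max nu 0 by rewrite le_max lexx.
have max_ge0 : 0 <= Num.max nu 0 by rewrite le_max lexx orbT.
have nur : nu < r by rewrite /r; lra.
have r0 : 0 < r by rewrite /r; lra.
have q2r : 2 * q < r by rewrite /r; lra.
pose z : R[i] := r%:C%C.
have z0 : z != 0 by rewrite fmorph_eq0 gt_eqF.
have rz : rnorm z = r by rewrite rnormC gtr0_norm.
have zh : right_half_plane nu z by [].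
have [MzK KMz] := binvP (iffLR (resolvent_setP z) (res z zh)).
pose B := binv (pencil M0 M1 z).
have Bc y : rnorm (B y) <= c * rnorm y.
  apply: le_trans (rnorm_opnorm _ _) _; apply: ler_wpM2r; first exact: rnorm_ge0.
  by apply: le_trans (opc z zh) _; rewrite le_max lexx.
have qr : q / r < 1 / 2 by rewrite ltr_pdivrMr//; lra.
(* The first row of the pencil makes the N(M0)^perp-component of order 1/r. *)
have wle (w : subsp Np) (x : H) : z *: tM0 w = - adj (emb Rg) (M1 x) ->
    rnorm w <= k * m / r * rnorm x.
  move=> E; have : rnorm (z *: tM0 w) <= m * rnorm x.
    by rewrite E rnormN; apply: le_trans (Mm x); apply: adj_emb_le.
  rewrite rnormZ rz => h; apply: le_trans (tk w) _.
  rewrite [X in _ <= X](_ : _ = k * (m * rnorm x / r)); last by field; rewrite gt_eqF.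
  by apply: ler_wpM2l => //; rewrite ler_pdivlMr// mulrC.
(* Completing x in N(M0) with the w that kills the first row gives
   M(z) (x + w) = D x + M1 w with w of order 1/r, and M(z) is bounded below. *)
have Dinj : injective D.
  apply: (@bounded_below_inj _ _ _ _ (2 * c)) => x.
  have [w wE] : exists w, z *: tM0 w = - adj (emb Rg) (M1 (emb N x)).
    exists (z^-1 *: binv tM0 (- adj (emb Rg) (M1 (emb N x)))).
    by rewrite bopZ scalerA mulfV// scale1r (binvP cinv_tM0).2.
  have wx := wle _ _ wE; rewrite rnorm_emb in wx.
  have Mz : pencil M0 M1 z (emb N x + emb Np w) = emb Rgp (D x) + M1 (emb Np w).
    rewrite pencilE bopD M0_emb_ker add0r -emb_tM0 -bopZ wE bopN.
    rewrite [M1 (_ + _)]bopD addrA; congr (_ + _).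
    by rewrite {2}(orth_decomp Rg (M1 (emb N x))) addKr.
  have := Bc (emb Rgp (D x) + M1 (emb Np w)); rewrite -Mz MzK => xw.
  have : rnorm x <= rnorm (emb N x + emb Np w) + rnorm w.
    rewrite -(rnorm_emb x) -(rnorm_emb w) -{1}[emb N x](addrK (emb Np w)).
    exact: rnormB.
  have h1 : rnorm (emb Rgp (D x) + M1 (emb Np w)) <= rnorm (D x) + m * rnorm w.
    apply: le_trans (rnormD _ _) _; rewrite rnorm_emb lerD2l.
    by apply: le_trans (Mm _) _; rewrite rnorm_emb.
  have h2 : c * rnorm (emb Rgp (D x) + M1 (emb Np w)) <=
      c * (rnorm (D x) + m * rnorm w) by apply: ler_wpM2l.
  rewrite Mz in xw.
  have h3 : (c * m + 1) * rnorm w <= q / r * rnorm x.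
    rewrite [X in _ <= X](_ : _ = (c * m + 1) * (k * m / r * rnorm x)); last first.
      by rewrite /q; field; rewrite gt_eqF.
    by apply: ler_wpM2l => //; rewrite addr_ge0// mulr_ge0.
  have h4 : q / r * rnorm x <= 1 / 2 * rnorm x.
    by apply: ler_wpM2r; [exact: rnorm_ge0|exact: ltW].
  by lra.
(* The lower right block of the inverse of M(z): D X - 1 is of order 1/r. *)
pose X := adj (emb N) \ob B \ob emb Rgp.
have DX : cont_invertible (D \ob X).
  have -> : D \ob X = bid _ + (D \ob X - bid _) by rewrite addrC subrK.
  apply: (@cinv_id_add _ _ _ (1 / 2)); [by []|lra|] => y.
  have -> : (D \ob X - bid _) y = D (X y) - y by [].
  pose u := B (emb Rgp y).
  have Mu : z *: M0 u + M1 u = emb Rgp y by rewrite -pencilE KMz.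
  pose w := adj (emb Np) u.
  have wE : z *: tM0 w = - adj (emb Rg) (M1 u).
    have tw : tM0 w = adj (emb Rg) (M0 u) by rewrite -(M0_proj u).
    by apply/eqP; rewrite -addr_eq0 tw -bopZ -bopD Mu adj_emb_orthl.
  have wy := wle _ _ wE.
  have uy : rnorm u <= c * rnorm y by apply: le_trans (Bc _) _; rewrite rnorm_emb.
  have DXy : D (X y) - y = - adj (emb Rgp) (M1 (emb Np w)).
    have {2}<- : adj (emb Rgp) (z *: M0 u + M1 u) = y by rewrite Mu adj_embK.
    rewrite bopD bopZ adj_emb_ran_orth_M0 scaler0 add0r.
    rewrite {1}(orth_decomp N u) [M1 (_ + _)]bopD [adj _ (_ + _)]bopD.
    have -> : D (X y) = adj (emb Rgp) (M1 (emb N (adj (emb N) u))) by [].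
    by rewrite opprD addNKr.
  rewrite DXy rnormN; apply: (le_trans (adj_emb_le _ _)).
  apply: le_trans (Mm _) _; rewrite rnorm_emb.
  have h1 : m * rnorm w <= m * (k * m / r * (c * rnorm y)).
    apply: ler_wpM2l => //; apply: le_trans wy _; apply: ler_wpM2l => //.
    by rewrite !mulr_ge0// invr_ge0 ltW.
  apply: le_trans h1 _.
  have -> : m * (k * m / r * (c * rnorm y)) = c * m * k * m / r * rnorm y by ring.
  apply: ler_wpM2r; first exact: rnorm_ge0.
  apply: le_trans (ltW qr); apply: ler_wpM2r; first by rewrite invr_ge0 ltW.
  by have := mulr_ge0 k0 m_ge0; rewrite /q; lra.
have [E [_ ED]] := DX.
have [XE EX] : cancel (X \ob E) D /\ cancel D (X \ob E).
  have EX' : cancel (X \ob E) D by move=> y; exact: (ED y).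
  by split=> // x; apply: Dinj; rewrite EX'.
by exists (X \ob E).
Qed.

End Regular.

(** * Factorization and its consequences *)

Hypothesis cD : cont_invertible D.

Let A := corner Np Rg M1.
Let B := corner N Rg M1.
Let C := corner Np Rgp M1.
Let tM1 := A - B \ob binv D \ob C.
Let U0 : bop H (dsum (subsp Np) (subsp N)) :=
  bcol (adj (emb Np)) (adj (emb N)).
Let U1 : bop H (dsum (subsp Rg) (subsp Rgp)) :=
  bcol (adj (emb Rg)) (adj (emb Rgp)).
Let V0 : bop (dsum (subsp Np) (subsp N)) (dsum (subsp Np) (subsp N)) :=
  bblock (bid (subsp Np)) 0 (binv D \ob C) (bid (subsp N)).
Let V1 : bop (dsum (subsp Rg) (subsp Rgp)) (dsum (subsp Rg) (subsp Rgp)) :=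
  bblock (bid (subsp Rg)) (B \ob binv D) 0 (bid (subsp Rgp)).
Let T (z : R[i]) := z *: tM0 + tM1.

Lemma pencil_factorization z :
  pencil M0 M1 z = adj U1 \ob V1 \ob bblock (T z) 0 0 D \ob V0 \ob U0.
Proof.
have [DK KD] := binvP cD.
apply: bop_ext => x; pose x1 := adj (emb Np) x; pose x2 := adj (emb N) x.
have adj_M1 S : adj (emb S) (M1 x) = corner Np S M1 x1 + corner N S M1 x2.
  have -> : corner Np S M1 x1 + corner N S M1 x2 =
    adj (emb S) (M1 (emb Np x1)) + adj (emb S) (M1 (emb N x2)) by [].
  by rewrite -!bopD addrC -orth_decomp.
pose e := binv D (C x1) + x2.
have De : D e = C x1 + D x2 by rewrite bopD KD.
have -> : (adj U1 \ob V1 \ob bblock (T z) 0 0 D \ob V0 \ob U0) x =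
  adj U1 (T z (x1 + 0) + 0 + B (binv D (0 + D e)), 0 + (0 + D e)) by [].
have U1E a b : adj U1 (a, b) = emb Rg a + emb Rgp b by rewrite adj_bcol_emb.
rewrite !addr0 !add0r DK De U1E -adj_M1.
have -> : T z x1 + B e = z *: tM0 x1 + adj (emb Rg) (M1 x).
  have -> : T z x1 = z *: tM0 x1 + (A x1 - B (binv D (C x1))) by [].
  by rewrite adj_M1 /e bopD -addrA; congr (_ + _); rewrite addrA subrK.
by rewrite bopD bopZ emb_tM0 M0_proj -addrA -orth_decomp.
Qed.

Lemma cinv_U0 : cont_invertible U0.
Proof.
(* [adj_bcol_emb] is about S and its complement in this order, whereas U0 lists
   N(M0)^perp first: hence the swap of coordinates. *)
pose W : bop (dsum (subsp Np) (subsp N)) H :=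
  adj (bcol (adj (emb N)) (adj (emb Np))) \ob bblock 0 (bid _) (bid _) 0.
have WE y : W y = emb N y.2 + emb Np y.1.
  have -> : W y = adj (bcol (adj (emb N)) (adj (emb Np)))
    (bblock 0 (bid _) (bid _) 0 y) by [].
  by rewrite adj_bcol_emb; case: y => y1 y2; rewrite bblockE !bop0E /= add0r addr0.
exists W; split => [x|[y1 y2]]; first by rewrite WE -orth_decomp.
by rewrite WE /U0 /=; congr (_, _);
  rewrite bopD ?adj_embK ?adj_emb_orthl ?adj_emb_orthr ?addr0 ?add0r.
Qed.

Lemma cinv_adjU1 : cont_invertible (adj U1).
Proof.
exists U1; split => [[y1 y2]|x]; rewrite adj_bcol_emb; last first.
  by rewrite -orth_decomp.
by rewrite /U1 /=; congr (_, _);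
  rewrite bopD ?adj_embK ?adj_emb_orthl ?adj_emb_orthr ?addr0 ?add0r.
Qed.

(** All factors of [pencil_factorization] other than the diagonal one are
    invertible independently of z, and so is the block D of the latter. *)
Lemma cinv_pencil z : cont_invertible (pencil M0 M1 z) <-> cont_invertible (T z).
Proof.
have cV0 : cont_invertible V0 by exact: cinv_lower.
have cV1 : cont_invertible V1 by exact: cinv_upper.
rewrite pencil_factorization; split.
  move=> /(cinv_compr cinv_U0)/(cinv_compr cV0).
  move=> /(cinv_compl (cinv_comp cinv_adjU1 cV1)).
  by move/(cinv_diag _ cD).
move=> /(cinv_diag _ cD) cT.
apply: (cinv_comp _ cinv_U0); apply: (cinv_comp _ cV0).
by apply: (cinv_comp _ cT); apply: (cinv_comp cinv_adjU1 cV1).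
Qed.

Lemma pencil_spectrumE :
  pencil_spectrum (pencil M0 M1) = spectrum (- (binv tM0 \ob tM1)).
Proof.
have [tK Kt] := binvP cinv_tM0.
apply/seteqP; suff E z : cont_invertible (pencil M0 M1 z) <->
    cont_invertible (- (binv tM0 \ob tM1) - z *: bid (subsp Np)).
  by split => z; rewrite /pencil_spectrum /spectrum /= scale0r subr0 => nz /E.
rewrite cinv_pencil -opprD cinv_opp.
have -> : T z = tM0 \ob (binv tM0 \ob tM1 + z *: bid (subsp Np)).
  apply: bop_ext => x.
  have -> : (tM0 \ob (binv tM0 \ob tM1 + z *: bid (subsp Np))) x =
    tM0 (binv tM0 (tM1 x) + z *: x) by [].
  by rewrite bopD Kt bopZ addrC.
by split => [/(cinv_compl cinv_tM0)//|]; apply: cinv_comp; exact: cinv_tM0.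
Qed.

(** Each factor is bounded below, the only one depending on z being z tM0 + tM1;
    its bound is 1 once |z| exceeds k (t + 1), where 1/k bounds tM0 from below
    and t bounds tM1 from above.  The bound for the product is a bound for the
    inverse of the pencil. *)
Lemma cinv_corner_regular : regular_pencil (pencil M0 M1).
Proof.
have cV0 : cont_invertible V0 by exact: cinv_lower.
have cV1 : cont_invertible V1 by exact: cinv_upper.
have [k0 k00 tk0] := cinv_bounded_below cinv_tM0.
(* k > 0 is needed to divide by k, even if the spaces are trivial. *)
pose k := k0 + 1; have k1 : 1 <= k by rewrite /k; lra.
have tk : bounded_below tM0 k.
  move=> x; apply: le_trans (tk0 x) _; apply: ler_wpM2r; first exact: rnorm_ge0.
  by rewrite /k; lra.
have [t t0 tt] := bop_rnorm tM1.
have [u0 u00 U0b] := cinv_bounded_below cinv_U0.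
have [u1 u10 U1b] := cinv_bounded_below cinv_adjU1.
have [v0 v00 V0b] := cinv_bounded_below cV0.
have [v1 v10 V1b] := cinv_bounded_below cV1.
have [d d0 Db] := cinv_bounded_below cD.
have kt0 : 0 <= k * t by rewrite mulr_ge0//; lra.
have Tz z : right_half_plane (k * t + k) z ->
    cont_invertible (T z) /\ bounded_below (T z) 1.
  move=> zh; have zl : k * t + k < rnorm z.
    apply: lt_le_trans zh _; apply: le_trans (rnorm_scalar_le z).1.
    exact: ler_norm.
  have nz : 0 < rnorm z by lra.
  have z0 : z != 0 by apply: contraTneq nz => ->; rewrite rnorm0 ltxx.
  have zk : bounded_below (z *: tM0) (k / rnorm z).
    move=> x; have -> : (z *: tM0) x = z *: tM0 x by [].
    by rewrite rnormZ mulrA divfK ?gt_eqF//; exact: tk.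
  split.
    apply: (@cinv_add _ _ _ _ _ (k / rnorm z) t) => //.
    - by rewrite mulrAC ltr_pdivrMr//; lra.
    - by apply: divr_ge0; [lra|exact: ltW].
    - exact/cinv_scale/cinv_tM0.
  move=> x; rewrite mul1r.
  have Tx : z *: tM0 x = T z x - tM1 x.
    have -> : T z x = z *: tM0 x + tM1 x by [].
    by rewrite addrK.
  have := zk x; rewrite mulrAC ler_pdivlMr//.
  have -> : (z *: tM0) x = z *: tM0 x by [].
  rewrite Tx => h.
  have h1 : k * rnorm (T z x - tM1 x) <= k * (rnorm (T z x) + t * rnorm x).
    apply: ler_wpM2l; first by lra.
    by apply: le_trans (rnormB _ _) _; rewrite lerD2l.
  have h2 : (k * t + k) * rnorm x <= rnorm x * rnorm z.
    by rewrite mulrC; apply: ler_wpM2l; [exact: rnorm_ge0|exact: ltW].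
  have h3 : k * rnorm x <= k * rnorm (T z x) by lra.
  by rewrite -(ler_pM2l (_ : 0 < k))//; lra.
exists (k * t + k); split => [z|].
  by move=> /Tz[/cinv_pencil ? _]; apply/resolvent_setP.
exists (u0 * (v0 * ((1 + d) * (v1 * u1)))) => z /Tz[cT Tb].
have /binvP[_ MK] : cont_invertible (pencil M0 M1 z) by apply/cinv_pencil.
apply: opnorm_le; first by rewrite !mulr_ge0// addr_ge0.
move=> y; rewrite -{2}[y]MK.
rewrite {2}pencil_factorization; apply: bounded_below_comp => //.
apply: bounded_below_comp => //; apply: bounded_below_comp; [exact: addr_ge0| |exact: bounded_below_diag].
exact: bounded_below_comp.
Qed.

End Proposition.

Theorem proposition3p2 (R : realType) (H : hilbertType R) (M0 M1 : bop H H)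
    (closed_ranM0 : closed (range M0)) :
  let N := ker M0 in
  let Np := orth N in
  let Rg := ran closed_ranM0 in
  let Rgp := orth Rg in
  let M := pencil M0 M1 in
  let D := corner N Rgp M1 in
  (regular_pencil M <-> cont_invertible D) /\
  (cont_invertible D ->
    let tM0 := corner Np Rg M0 in
    let tM1 := corner Np Rg M1
               - corner N Rg M1 \ob binv D \ob corner Np Rgp M1 in
    let U0 : bop H (dsum (subsp Np) (subsp N)) :=
      bcol (adj (emb Np)) (adj (emb N)) in
    let U1 : bop H (dsum (subsp Rg) (subsp Rgp)) :=
      bcol (adj (emb Rg)) (adj (emb Rgp)) in
    let V0 : bop (dsum (subsp Np) (subsp N)) (dsum (subsp Np) (subsp N)) :=
      bblock (bid (subsp Np)) 0
             (binv D \ob corner Np Rgp M1) (bid (subsp N)) in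
    let V1 : bop (dsum (subsp Rg) (subsp Rgp)) (dsum (subsp Rg) (subsp Rgp)) :=
      bblock (bid (subsp Rg)) (corner N Rg M1 \ob binv D)
             0 (bid (subsp Rgp)) in
    [/\ cont_invertible tM0,
        pencil_spectrum M = spectrum (- (binv tM0 \ob tM1)),
        compact (pencil_spectrum M) &
        forall z : R[i],
          M z = adj U1 \ob V1 \ob bblock (z *: tM0 + tM1) 0 0 D \ob V0 \ob U0]).
Proof.
move=> N Np Rg Rgp M D; split.
  by split; [exact: regular_cinv_corner|exact: cinv_corner_regular].
move=> cD; split.
- exact: cinv_tM0.
- exact: pencil_spectrumE.
- by rewrite (pencil_spectrumE cD); exact: compact_spectrum.
- exact: pencil_factorization.
Qed.
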